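(* Let $(\rho,v)$ and $(\widetilde\rho,\widetilde v)$ be two convex integration realizations generated by the same admissible piecewise constant fan subsolution. Then $$\mathcal L(\rho,v)=\mathcal L(\widetilde\rho,\widetilde v),\qquad H(\rho,v)=H(\widetilde\rho,\widetilde v)\qquad\text{almost everywhere}.$$ Consequently, $(\rho,v)$ and $(\widetilde\rho,\widetilde v)$ have the same action $\int\!\!\int \mathcal L\,dx\,dt$ on every bounded spacetime set, and the same total-energy rate relative to any common reference solution (i.e. the differences of total energies $\mathcal E(\rho,v,t)-\mathcal E(\rho^{\mathrm{ref}},v^{\mathrm{ref}},t)$ and $\mathcal E(\widetilde\rho,\widetilde v,t)-\mathcal E(\rho^{\mathrm{ref}},v^{\mathrm{ref}},t)$, and hence their rates, coincide).
   Context: Pressure law: $p$ is a sufficiently smooth function on $(0,\infty)$ with $p'>0$, and the specific internal energy $e$ satisfies $p(\rho)=\rho^2e'(\rho)$. Isentropic Euler equations in two space dimensions: $\partial_t\rho+\mathrm{div}(\rho v)=0$, $\partial_t(\rho v)+\mathrm{div}(\rho v\otimes v)+\nabla p(\rho)=0$. Energy and Lagrangian densities: $H(\rho,v)=\tfrac12\rho|v|^2+\rho e(\rho)$, $\mathcal L(\rho,v)=\tfrac12\rho|v|^2-\rho e(\rho)$. A bounded entropic weak solution is a pair $(\rho,v)\in L^\infty$ with $\rho>0$ a.e. that solves the Euler equations in the sense of distributions and satisfies $\partial_tH+\mathrm{div}((H+p(\rho))v)\le0$ in the sense of distributions. Riemann data: $(\rho_-,v_-)$ for $x_2<0$ and $(\rho_+,v_+)$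 for $x_2>0$, with constants $\rho_\pm>0$, $v_\pm\in\mathbb R^2$. Admissible piecewise constant fan subsolution: constants $\rho_i>0$, $v_i\in\mathbb R^2$, $u_i$ a trace-free symmetric $2\times2$ real matrix, $C_i>0$ ($i=1,\dots,N$), and speeds $\nu_0<\nu_1<\dots<\nu_N$. Put $P_-=\{t>0,\,x_2<\nu_0t\}$, $P_i=\{t>0,\,\nu_{i-1}t<x_2<\nu_it\}$, $P_+=\{t>0,\,x_2>\nu_Nt\}$, and let $\bar\rho,\bar v,\bar u,\bar C$ be the piecewise constant fields with values $\rho_i,v_i,u_i,C_i$ in $P_i$ and $\rho_\pm,\ v_\pm,\ v_\pm\otimes v_\pm-\tfrac12|v_\pm|^2\mathrm{Id},\ |v_\pm|^2$ in $P_\pm$. One requires $v_i\otimes v_i-u_i<\tfrac{C_i}{2}\mathrm{Id}$ for all $i$; the relaxed equations $\partial_t\bar\rho+\mathrm{div}(\bar\rho\bar v)=0$, $\partial_t(\bar\rho\bar v)+\mathrm{div}(\bar\rho\bar u)+\nabla(p(\bar\rho)+\tfrac12\bar\rho\bar C)=0$ (equivalently, the Rankine–Hugoniot relations at every interface); and the admissibility inequality $\partial_t\bar H+\mathrm{div}((\bar H+p(\bar\rho))\bar v)\le0$ with $\bar H=\tfrac12\bar\rho\bar C+\bar\rho e(\bar\rho)$. A convex integration realization generated by the fan is a bounded entropic weak solution $(\rho,v)$ with the same Riemann data such that $\rho=\bar\rho$ a.e., $v=v_\pm$ in $P_\pm$, and $|v|^2=C_i$ a.e. in $P_i$, $i=1,\dots,N$.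 Energy differences of two solutions with the same Riemann data are computed on the strip $\Omega_\ell=(\mathbb R/\ell\mathbb Z)\times\mathbb R$, $\ell>0$: $\mathcal E(\rho^{(1)},v^{(1)},t)-\mathcal E(\rho^{(2)},v^{(2)},t)=\int_{\Omega_\ell}[H(\rho^{(1)},v^{(1)})-H(\rho^{(2)},v^{(2)})]\,dx$. For fixed-time statements, the almost-everywhere identities of a realization are understood to hold for a.e. $x$ at the time $t$ considered. *)

(* Defs.v *)
From HB Require Import structures.
From mathcomp Require Import all_boot all_order all_algebra.
From mathcomp Require Import all_classical all_reals all_analysis.

Set Implicit Arguments.
Unset Strict Implicit.
Unset Printing Implicit Defensive.

Import Order.TTheory GRing.Theory Num.Theory.
Import numFieldNormedType.Exports.

Local Open Scope classical_set_scope.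
Local Open Scope ring_scope.

(* Points of the plane are x = (x_1, x_2) and points of spacetime are
   z = (t, (x_1, x_2)), both with Lebesgue measure on the Borel sets. Velocities
   are column vectors. *)
Definition plane (R : realType) := (measurableTypeR R * measurableTypeR R)%type.

Definition spacetime (R : realType) := (measurableTypeR R * plane R)%type.

Definition plane_measure (R : realType) : set (plane R) -> \bar R :=
  (@lebesgue_measure R \x @lebesgue_measure R)%E.
Arguments plane_measure : clear implicits.

HB.instance Definition _ (R : realType) := Measure.on (plane_measure R).

(* Canonical inference does not find the library's sigma-finite structure on
   product measures; the product with the time axis needs it. *)
Lemma plane_measure_sigma_finite (R : realType) :
  sigma_finite setT (plane_measure R).
Proof.
have /sigma_finiteP[F [TF ndF Foo]] := sigma_finiteT (@lebesgue_measure R).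
exists (fun n => F n `*` F n).
  rewrite -setXTT TF predeqE => -[x y]; split.
    move=> [/= [n _ Fnx] [k _ Gky]]; exists (maxn n k) => //; split.
    - by move: x Fnx; exact/subsetPset/ndF/leq_maxl.
    - by move: y Gky; exact/subsetPset/ndF/leq_maxr.
  by move=> [n _ []/= ? ?]; split; exists n.
move=> k; have [? ?] := Foo k.
split; first exact: measurableX.
by rewrite /plane_measure product_measure1E// lte_mul_pinfty// ge0_fin_numE.
Qed.

HB.instance Definition _ (R : realType) := Measure_isSigmaFinite.Build _ _ _
  (plane_measure R) (@plane_measure_sigma_finite R).

Definition spacetime_measure (R : realType) : set (spacetime R) -> \bar R :=
  (@lebesgue_measure R \x plane_measure R)%E.
Arguments spacetime_measure : clear implicits.

HB.instance Definition _ (R : realType) := Measure.on (spacetime_measure R).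

Definition future (R : realType) : set (spacetime R) := [set z | 0 < z.1].
Arguments future : clear implicits.

(* The Euclidean |v|^2; the library's `|v| on matrices is the sup norm. *)
Definition sqnorm (R : realType) (v : 'cV[R]_2) : R := \sum_(i < 2) v i 0 ^+ 2.

Definition posdefmx (R : realType) (A : 'M[R]_2) : Prop :=
  forall x : 'cV[R]_2, x != 0 -> 0 < (x^T *m A *m x) 0 0.

(* "Sufficiently smooth" is read as C^1, the least regularity for which p' > 0
   makes sense classically. As functions on R, p and e carry arbitrary values on
   (-oo, 0]; the two measurability clauses only restrict these values, since the
   other clauses make p and e continuous on (0, +oo). *)
Record pressure_law (R : realType) (p e : R -> R) : Prop := PressureLaw {
  p_derivable : forall r : R, 0 < r -> derivable p r 1;
  p_C1 : forall r : R, 0 < r -> {for r, continuous (derive1 p)};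
  p_increasing : forall r : R, 0 < r -> 0 < derive1 p r;
  e_derivable : forall r : R, 0 < r -> derivable e r 1;
  p_of_e : forall r : R, 0 < r -> p r = r ^+ 2 * derive1 e r;
  p_measurable : measurable_fun setT p;
  e_measurable : measurable_fun setT e }.

Definition energy_density (R : realType) (e : R -> R) (r : R) (v : 'cV[R]_2) : R :=
  2^-1 * r * sqnorm v + r * e r.

Definition lagrangian_density (R : realType) (e : R -> R) (r : R) (v : 'cV[R]_2)
    : R :=
  2^-1 * r * sqnorm v - r * e r.

Definition dir_t (R : realType) : spacetime R := (1, (0, 0)).
Arguments dir_t : clear implicits.

Definition dir_x (R : realType) (j : 'I_2) : spacetime R :=
  (0, ((j == 0)%:R, (j == 1)%:R)).

Definition smooth (R : realType) (phi : spacetime R -> R) : Prop :=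
  forall (ds : seq (spacetime R)) (z : spacetime R),
    differentiable (foldr (fun d (f : spacetime R -> R) => 'D_d f) phi ds) z.

Definition test_function (R : realType) (X : set (spacetime R))
    (phi : spacetime R -> R) : Prop :=
  let supp := closure [set z | phi z != 0] in
  [/\ smooth phi, compact supp & supp `<=` X].

(* Integrability of f, as a function of positive times, on the compact subsets of
   X; for X = setT this is local integrability on [0, +oo) x R^2. *)
Definition loc_integrable (R : realType) (X : set (spacetime R))
    (f : spacetime R -> R) : Prop :=
  forall K : set (spacetime R), compact K -> K `<=` X ->
    (spacetime_measure R).-integrable (K `&` future R) (EFin \o f).

Definition loc_integrable_pair (R : realType) (X : set (spacetime R))
    (U : spacetime R -> R) (F : spacetime R -> 'cV[R]_2) : Prop :=
  loc_integrable X U /\ forall j, loc_integrable X (fun z => F z j 0).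

(* The pairing of - (d_t U + div F) with phi, for t > 0. *)
Definition weak_pairing (R : realType) (U : spacetime R -> R)
    (F : spacetime R -> 'cV[R]_2) (phi : spacetime R -> R) : R :=
  \int[spacetime_measure R]_(z in future R)
    (U z * 'D_(dir_t R) phi z + \sum_(j < 2) F z j 0 * 'D_(dir_x R j) phi z).

(* d_t U + div F = 0 in the sense of distributions on (0, +oo) x R^2. *)
Definition distr_conservation (R : realType) (U : spacetime R -> R)
    (F : spacetime R -> 'cV[R]_2) : Prop :=
  loc_integrable_pair (future R) U F /\
  forall phi, test_function (future R) phi -> weak_pairing U F phi = 0.

(* d_t U + div F <= 0 in the sense of distributions on (0, +oo) x R^2. *)
Definition distr_dissipation (R : realType) (U : spacetime R -> R)
    (F : spacetime R -> 'cV[R]_2) : Prop :=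
  loc_integrable_pair (future R) U F /\
  forall phi, test_function (future R) phi -> (forall z, 0 <= phi z) ->
    0 <= weak_pairing U F phi.

(* d_t U + div F = 0 with U = U0 at t = 0: the test functions need not vanish at
   t = 0, so the initial datum enters through the boundary term. *)
Definition cauchy_conservation (R : realType) (U : spacetime R -> R)
    (F : spacetime R -> 'cV[R]_2) (U0 : plane R -> R) : Prop :=
  loc_integrable_pair setT U F /\
  forall phi, test_function setT phi ->
    weak_pairing U F phi + \int[plane_measure R]_x (U0 x * phi (0, x)) = 0.

Record riemann_data (R : realType) := RiemannData {
  rho_minus : R;
  rho_plus : R;
  v_minus : 'cV[R]_2;
  v_plus : 'cV[R]_2;
  rho_minus_gt0 : 0 < rho_minus;
  rho_plus_gt0 : 0 < rho_plus }.

Definition riemann_field (R : realType) (am ap : R) (x : plane R) : R :=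
  if x.2 < 0 then am else ap.

Record entropic_weak_solution (R : realType) (p e : R -> R) (D : riemann_data R)
    (rho : spacetime R -> R) (v : spacetime R -> 'cV[R]_2) : Prop :=
  EntropicWeakSolution {
  density_bounded :
    rho \_ (future R) \in Lfun (spacetime_measure R) +oo%E;
  velocity_bounded : forall i,
    (fun z => v z i 0) \_ (future R) \in Lfun (spacetime_measure R) +oo%E;
  density_positive :
    \forall z \ae spacetime_measure R, future R z -> 0 < rho z;
  mass_equation :
    cauchy_conservation rho (fun z => rho z *: v z)
      (riemann_field (rho_minus D) (rho_plus D));
  momentum_equation : forall k,
    cauchy_conservation (fun z => rho z * v z k 0)
      (fun z => (row k (rho z *: (v z *m (v z)^T) + (p (rho z))%:M))^T)
      (riemann_field (rho_minus D * v_minus D k 0) (rho_plus D * v_plus D k 0));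
  energy_inequality :
    distr_dissipation (fun z => energy_density e (rho z) (v z))
      (fun z => (energy_density e (rho z) (v z) + p (rho z)) *: v z) }.

(* Indices start at 0: the i-th sector, i < N, lies between the rays of speeds fan_nu i and
   fan_nu (i + 1). *)
Record fan (R : realType) (N : nat) := Fan {
  fan_nu : 'I_N.+1 -> R;
  fan_rho : 'I_N -> R;
  fan_v : 'I_N -> 'cV[R]_2;
  fan_u : 'I_N -> 'M[R]_2;
  fan_C : 'I_N -> R }.

Definition sector_minus (R : realType) (N : nat) (F : fan R N)
    : set (spacetime R) :=
  [set z | 0 < z.1 /\ z.2.2 < fan_nu F ord0 * z.1].

Definition sector (R : realType) (N : nat) (F : fan R N) (i : 'I_N)
    : set (spacetime R) :=
  [set z | 0 < z.1 /\
    fan_nu F (widen_ord (leqnSn N) i) * z.1 < z.2.2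
      < fan_nu F (lift ord0 i) * z.1].

Definition sector_plus (R : realType) (N : nat) (F : fan R N)
    : set (spacetime R) :=
  [set z | 0 < z.1 /\ fan_nu F ord_max * z.1 < z.2.2].

(* The value on the interfaces, a null set, is immaterial. *)
Definition fan_field (R : realType) (N : nat) (F : fan R N) (T : Type)
    (am : T) (a : 'I_N -> T) (ap : T) (z : spacetime R) : T :=
  if z \in sector_minus F then am
  else if [pick i | z \in sector F i] is Some i then a i else ap.

Definition outer_u (R : realType) (v : 'cV[R]_2) : 'M[R]_2 :=
  v *m v^T - (2^-1 * sqnorm v)%:M.

Definition rho_bar (R : realType) (N : nat) (D : riemann_data R) (F : fan R N) :=
  fan_field F (rho_minus D) (fan_rho F) (rho_plus D).

Definition v_bar (R : realType) (N : nat) (D : riemann_data R) (F : fan R N) :=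
  fan_field F (v_minus D) (fan_v F) (v_plus D).

Definition u_bar (R : realType) (N : nat) (D : riemann_data R) (F : fan R N) :=
  fan_field F (outer_u (v_minus D)) (fan_u F) (outer_u (v_plus D)).

Definition C_bar (R : realType) (N : nat) (D : riemann_data R) (F : fan R N) :=
  fan_field F (sqnorm (v_minus D)) (fan_C F) (sqnorm (v_plus D)).

Definition H_bar (R : realType) (N : nat) (e : R -> R) (D : riemann_data R)
    (F : fan R N) (z : spacetime R) : R :=
  2^-1 * rho_bar D F z * C_bar D F z + rho_bar D F z * e (rho_bar D F z).

Record admissible_fan_subsolution (R : realType) (N : nat) (p e : R -> R)
    (D : riemann_data R) (F : fan R N) : Prop := AdmissibleFanSubsolution {
  fan_nu_increasing : forall i j : 'I_N.+1, (i < j)%N -> fan_nu F i < fan_nu F j;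
  fan_rho_gt0 : forall i, 0 < fan_rho F i;
  fan_u_sym : forall i, (fan_u F i)^T = fan_u F i;
  fan_u_tracefree : forall i, \tr (fan_u F i) = 0;
  fan_C_gt0 : forall i, 0 < fan_C F i;
  fan_subsolution : forall i,
    posdefmx ((fan_C F i / 2)%:M - (fan_v F i *m (fan_v F i)^T - fan_u F i));
  fan_mass :
    distr_conservation (rho_bar D F) (fun z => rho_bar D F z *: v_bar D F z);
  fan_momentum : forall k,
    distr_conservation (fun z => rho_bar D F z * v_bar D F z k 0)
      (fun z => (row k (rho_bar D F z *: u_bar D F z
        + (p (rho_bar D F z) + 2^-1 * rho_bar D F z * C_bar D F z)%:M))^T);
  fan_energy :
    distr_dissipation (H_bar e D F)
      (fun z => (H_bar e D F z + p (rho_bar D F z)) *: v_bar D F z) }.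

Definition realizes_at_point (R : realType) (N : nat) (D : riemann_data R)
    (F : fan R N) (rho : spacetime R -> R) (v : spacetime R -> 'cV[R]_2)
    (z : spacetime R) : Prop :=
  [/\ rho z = rho_bar D F z,
      sector_minus F z -> v z = v_minus D,
      sector_plus F z -> v z = v_plus D &
      forall i, sector F i z -> sqnorm (v z) = fan_C F i].

Definition realizes_at_time (R : realType) (N : nat) (D : riemann_data R)
    (F : fan R N) (rho : spacetime R -> R) (v : spacetime R -> 'cV[R]_2)
    (t : R) : Prop :=
  \forall x \ae plane_measure R, realizes_at_point D F rho v (t, x).

Record convex_integration_realization (R : realType) (N : nat) (p e : R -> R)
    (D : riemann_data R) (F : fan R N)
    (rho : spacetime R -> R) (v : spacetime R -> 'cV[R]_2) : Prop :=
  ConvexIntegrationRealization {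
  realization_solution : entropic_weak_solution p e D rho v;
  realization_ae : \forall z \ae spacetime_measure R,
    future R z -> realizes_at_point D F rho v z }.

(* A fundamental domain of (R / l Z) x R: for fields that are l-periodic in x_1
   the integral over the cylinder is the integral over this strip. *)
Definition strip (R : realType) (l : R) : set (plane R) :=
  [set x | 0 <= x.1 < l].

Definition energy_gap_density (R : realType) (e : R -> R)
    (rho1 : spacetime R -> R) (v1 : spacetime R -> 'cV[R]_2)
    (rho2 : spacetime R -> R) (v2 : spacetime R -> 'cV[R]_2)
    (t : R) (x : plane R) : \bar R :=
  (energy_density e (rho1 (t, x)) (v1 (t, x))
   - energy_density e (rho2 (t, x)) (v2 (t, x)))%:E.

Definition energy_gap_defined (R : realType) (e : R -> R) (l : R)
    (rho1 : spacetime R -> R) (v1 : spacetime R -> 'cV[R]_2)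
    (rho2 : spacetime R -> R) (v2 : spacetime R -> 'cV[R]_2) (t : R) : Prop :=
  (plane_measure R).-integrable (strip l)
    (energy_gap_density e rho1 v1 rho2 v2 t).

Definition energy_gap (R : realType) (e : R -> R) (l : R)
    (rho1 : spacetime R -> R) (v1 : spacetime R -> 'cV[R]_2)
    (rho2 : spacetime R -> R) (v2 : spacetime R -> 'cV[R]_2) (t : R) : \bar R :=
  (\int[plane_measure R]_(x in strip l)
    energy_gap_density e rho1 v1 rho2 v2 t x)%E.

(* r is the rate at time t of the energy difference: two-sided for G = t^', from
   the right for G = t^'+. *)
Definition energy_rate (R : realType) (G : set_system R) (e : R -> R) (l : R)
    (rho1 : spacetime R -> R) (v1 : spacetime R -> 'cV[R]_2)
    (rho2 : spacetime R -> R) (v2 : spacetime R -> 'cV[R]_2) (t r : R) : Prop :=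
  let gap s := energy_gap e l rho1 v1 rho2 v2 s in
  [/\ energy_gap_defined e l rho1 v1 rho2 v2 t,
      \forall s \near G, energy_gap_defined e l rho1 v1 rho2 v2 s &
      (fine (gap s) - fine (gap t)) / (s - t) @[s --> G] --> r].

(* Main.v *)
Require Import Defs.
From HB Require Import structures.
From mathcomp Require Import all_boot all_order all_algebra.
From mathcomp Require Import all_classical all_reals all_analysis.
From mathcomp Require Import measurable_realfun.

Set Implicit Arguments.
Unset Strict Implicit.
Unset Printing Implicit Defensive.

Import Order.TTheory GRing.Theory Num.Theory.
Import numFieldNormedType.Exports.

Local Open Scope classical_set_scope.
Local Open Scope ring_scope.

(** Both densities depend on the velocity only through |v|^2.  Two realizations
    of one fan have the same density, the fan's, and inside each sector |v|^2 is
    prescribed as well: it is the constant C_i in the inner sectors and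
    |v_-|^2, |v_+|^2 in the outer ones.  So the convex integration freedom, the
    direction of v, is invisible to the Lagrangian and to the energy: at every
    point of a sector where both fields realize the fan the two values agree
    ([densities_realization]).

    The sectors miss only the rays x_2 = nu_i t.  These are null in spacetime,
    and each time slice of them is a null line of the plane, so the agreement
    holds almost everywhere in spacetime ([ae_off_interfaces]) and, at a time
    when the realization identities hold, almost everywhere in the plane
    ([ae_off_interfaces_slice]).

    The integral statements follow since almost everywhere equal functions have
    equal integrals.  The Lebesgue measures here live on the Borel sets and are
    not complete, so measurability does not pass through an almost everywhere
    identity; it comes from the fields being in L^oo, first on t > 0 and then on
    each time slice, as sections of measurable functions are measurable.  The
    action of a bounded set is finite because the Lagrangian takes almost
    everywhere one of finitely many values ([lagrangian_bounded]).  The energy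
    gaps of the two realizations coincide at every time at which both realize the
    fan ([energy_gap_realization]); if these include t and all times near t, the
    difference quotients and their limits coincide too ([energy_rate_congr]).
*)

(** * Measurability of the densities *)

Lemma measurable_sqnorm d (T : measurableType d) (R : realType) (A : set T)
    (v : T -> 'cV[R]_2) :
  (forall i, measurable_fun A (fun z => v z i 0)) ->
  measurable_fun A (fun z => sqnorm (v z)).
Proof.
by move=> mv; apply: measurable_sum => i; apply: measurable_funX; exact: mv.
Qed.

Lemma measurable_kinetic d (T : measurableType d) (R : realType) (A : set T)
    (rho : T -> R) (v : T -> 'cV[R]_2) :
  measurable_fun A rho -> (forall i, measurable_fun A (fun z => v z i 0)) ->
  measurable_fun A (fun z => 2^-1 * rho z * sqnorm (v z)).
Proof.
move=> mrho mv; apply: measurable_funM; last exact: measurable_sqnorm.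
by apply: measurable_funM => //; exact: measurable_cst.
Qed.

Lemma measurable_internal d (T : measurableType d) (R : realType) (A : set T)
    (e : R -> R) (rho : T -> R) :
  measurable_fun setT e -> measurable_fun A rho ->
  measurable_fun A (fun z => rho z * e (rho z)).
Proof.
by move=> me mrho; apply: measurable_funM => //; exact: measurableT_comp.
Qed.

Lemma measurable_energy_density d (T : measurableType d) (R : realType)
    (A : set T) (e : R -> R) (rho : T -> R) (v : T -> 'cV[R]_2) :
  measurable_fun setT e -> measurable_fun A rho ->
  (forall i, measurable_fun A (fun z => v z i 0)) ->
  measurable_fun A (fun z => energy_density e (rho z) (v z)).
Proof.
move=> me mrho mv; apply: measurable_funD; first exact: measurable_kinetic.
exact: measurable_internal.
Qed.

Lemma measurable_lagrangian_density d (T : measurableType d) (R : realType)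
    (A : set T) (e : R -> R) (rho : T -> R) (v : T -> 'cV[R]_2) :
  measurable_fun setT e -> measurable_fun A rho ->
  (forall i, measurable_fun A (fun z => v z i 0)) ->
  measurable_fun A (fun z => lagrangian_density e (rho z) (v z)).
Proof.
move=> me mrho mv; apply: measurable_funB; first exact: measurable_kinetic.
exact: measurable_internal.
Qed.

Lemma measurable_future (R : realType) : measurable (future R).
Proof.
rewrite (_ : future R = `]0, +oo[%classic `*` setT); last first.
  by apply/seteqP; split=> z /=; rewrite in_itv /= andbT // => -[].
by apply: measurableX => //; exact: measurable_itv.
Qed.

Lemma measurable_strip (R : realType) (l : R) : measurable (strip l).
Proof.
rewrite (_ : strip l = `[0, l[%classic `*` setT); last first.
  by apply/seteqP; split=> x /=; rewrite /strip /= in_itv //= => -[].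
by apply: measurableX => //; exact: measurable_itv.
Qed.

Lemma measurable_fun_future (R : realType) (f : spacetime R -> R) :
  f \_ (future R) \in Lfun (spacetime_measure R) +oo%E ->
  measurable_fun (future R) f.
Proof.
move=> /andP[+ _]; rewrite inE /= => mf.
by apply/(measurable_restrictT _ (@measurable_future R)).
Qed.

(** At a fixed time the realization identities hold only almost everywhere in
    the plane, which would leave the Borel measurability of the time slice open;
    here it is inherited from spacetime. *)
Lemma measurable_fun_slice (R : realType) (f : spacetime R -> R) (t : R) :
  0 < t -> measurable_fun (future R) f ->
  measurable_fun setT (fun x : plane R => f (t, x)).
Proof.
move=> t0 mf; apply: (measurable_comp (@measurable_future R) _ mf).
  by move=> _ [x _ <-].
exact: pair1_measurable.
Qed.

(** * The interfaces are null sets *)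

Lemma ae_neq_interface_plane (R : realType) (c : R) :
  \forall x \ae plane_measure R, x.2 != c.
Proof.
exists (setT `*` [set c]); split.
- exact: measurableX.
- by rewrite /plane_measure product_measure1E //= lebesgue_measure_set1 mule0.
- by move=> x /= /negP; rewrite negbK => /eqP.
Qed.

(** The section of the ray at time t is the line x_2 = nu t, which is null for
    every t; the product measure integrates these measures in t. *)
Lemma ae_neq_interface_spacetime (R : realType) (nu : R) :
  \forall z \ae spacetime_measure R, z.2.2 != nu * z.1.
Proof.
pose f (z : spacetime R) : R := z.2.2 - nu * z.1.
have mf : measurable_fun setT f.
  apply: measurable_funB; first exact: measurableT_comp.
  by apply: measurable_funM.
exists (f @^-1` [set 0]); split.
- by rewrite -[X in measurable X]setTI; exact: mf.
- apply: integral0_eq => t _ /=.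
  have [N [mN N0 sN]] := ae_neq_interface_plane (nu * t).
  apply: (subset_measure0 _ mN _ N0).
    by apply: measurable_xsection; rewrite -[X in measurable X]setTI; exact: mf.
  move=> x; rewrite /xsection /= inE /f /= => /eqP; rewrite subr_eq0 => xt.
  by apply: sN => /=; rewrite xt.
- by move=> z /= /negP; rewrite negbK /f => /eqP ->; rewrite subrr.
Qed.

Definition off_interfaces (R : realType) (N : nat) (F : fan R N)
    (z : spacetime R) : Prop :=
  forall i, z.2.2 != fan_nu F i * z.1.

Lemma ae_off_interfaces (R : realType) (N : nat) (F : fan R N) :
  \forall z \ae spacetime_measure R, off_interfaces F z.
Proof. by apply: filter_forall => i; exact: ae_neq_interface_spacetime. Qed.

Lemma ae_off_interfaces_slice (R : realType) (N : nat) (F : fan R N) (t : R) :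
  \forall x \ae plane_measure R, off_interfaces F (t, x).
Proof.
apply: filter_forall => i.
exact: (ae_neq_interface_plane (fan_nu F i * t)).
Qed.

(** * Realizations have the same densities *)

(** The sectors and the interfaces cover t > 0.  Crossing the interfaces from
    below, a point that is above the interface k, not in the sector k and not on
    the interface k + 1 is above the latter; so it is above all of them. *)
Lemma sector_plus_of_not_sector (R : realType) (N : nat) (F : fan R N)
    (z : spacetime R) :
  future R z -> off_interfaces F z -> ~ sector_minus F z ->
  (forall i, ~ sector F i z) -> sector_plus F z.
Proof.
move=> z0 zF zm zi; split=> //.
suff H k (kN : (k < N.+1)%N) : fan_nu F (Ordinal kN) * z.1 < z.2.2.
  by rewrite (_ : ord_max = Ordinal (ltnSn N)) //; exact: val_inj.
elim: k kN => [|k IH] kN.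
  have -> : Ordinal kN = ord0 by exact: val_inj.
  have := zF ord0; case: ltgtP => // zlt _; by case: zm.
have := zF (Ordinal kN); case: ltgtP => // zlt _.
case: (zi (Ordinal (kN : (k < N)%N))); split=> //; apply/andP; split.
  by have := IH (ltnW kN); congr (fan_nu F _ * _ < _); exact: val_inj.
by move: zlt; congr (_ < fan_nu F _ * _); exact: val_inj.
Qed.

(** The right-hand side depends on the fan and the point alone, so two
    realizations can be compared through it. *)
Lemma sqnorm_realization (R : realType) (N : nat) (D : riemann_data R)
    (F : fan R N) (rho : spacetime R -> R) (v : spacetime R -> 'cV[R]_2)
    (z : spacetime R) :
  future R z -> off_interfaces F z -> realizes_at_point D F rho v z ->
  sqnorm (v z) = C_bar D F z.
Proof.
move=> z0 zF [_ vm vp vi]; rewrite /C_bar /fan_field.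
case: ifPn => [|zm]; first by rewrite inE => /vm ->.
case: pickP => [i|zi]; first by rewrite inE => /vi.
rewrite vp //; apply: sector_plus_of_not_sector => //.
  by move=> /mem_set; apply/negP.
by move=> i /mem_set; rewrite zi.
Qed.

Lemma densities_realization (R : realType) (N : nat) (e : R -> R)
    (D : riemann_data R) (F : fan R N) (rho rho' : spacetime R -> R)
    (v v' : spacetime R -> 'cV[R]_2) (z : spacetime R) :
  future R z -> off_interfaces F z ->
  realizes_at_point D F rho v z -> realizes_at_point D F rho' v' z ->
  lagrangian_density e (rho z) (v z) = lagrangian_density e (rho' z) (v' z) /\
  energy_density e (rho z) (v z) = energy_density e (rho' z) (v' z).
Proof.
move=> z0 zF zr zr'; rewrite /lagrangian_density /energy_density.
rewrite (sqnorm_realization z0 zF zr) (sqnorm_realization z0 zF zr').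
by case: zr zr' => -> _ _ _ [-> _ _ _].
Qed.

(** * The action on bounded sets *)

Lemma fan_field_bounded (R : realType) (N : nat) (F : fan R N) (am : R)
    (a : 'I_N -> R) (ap : R) :
  exists M, forall z, `|fan_field F am a ap z| <= M.
Proof.
exists (`|am| + \sum_i `|a i| + `|ap|) => z.
have sum_ge0 : 0 <= \sum_i `|a i| by exact: sumr_ge0.
rewrite /fan_field; case: ifP => _; first by rewrite -addrA lerDl addr_ge0.
case: pickP => [i _|_]; last by rewrite lerDr addr_ge0.
by rewrite (bigD1 i) //= addrCA -!addrA lerDl !addr_ge0 // sumr_ge0.
Qed.

(** One bound serves all realizations: off the interfaces their Lagrangian is
    a fan field, with one value per sector. *)
Lemma lagrangian_bounded (R : realType) (N : nat) (e : R -> R)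
    (D : riemann_data R) (F : fan R N) :
  exists M, forall rho v z, future R z -> off_interfaces F z ->
    realizes_at_point D F rho v z ->
    `|lagrangian_density e (rho z) (v z)| <= M.
Proof.
(* L is the Lagrangian as a function of the density and of C = |v|^2. *)
pose L r C : R := 2^-1 * r * C - r * e r.
have [M HM] := fan_field_bounded F
  (L (rho_minus D) (sqnorm (v_minus D)))
  (fun i => L (fan_rho F i) (fan_C F i))
  (L (rho_plus D) (sqnorm (v_plus D))).
exists M => rho v z z0 zF zr; rewrite /lagrangian_density.
rewrite (sqnorm_realization z0 zF zr); case: zr => -> _ _ _.
move: (HM z); rewrite /rho_bar /C_bar /fan_field.
by case: ifP => // _; case: pickP.
Qed.

Lemma bounded_set_finite_measure (R : realType) (A : set (spacetime R)) :
  measurable A -> bounded_set A -> (spacetime_measure R A < +oo)%E.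
Proof.
(* The norm of a product is the maximum of the norms, so A lies in a cube. *)
move=> mA [M0 [_ /(_ (M0 + 1))]]; rewrite ltrDl ltr01 => /(_ isT).
move: (M0 + 1) => M AM.
pose I : set (measurableTypeR R) := `[- M, M]%classic.
have mI : measurable I by exact: measurable_itv.
have AI : A `<=` I `*` (I `*` I).
  move=> z /AM; rewrite /= !prod_normE !ge_max => /andP[h1 /andP[h2 h3]].
  by rewrite /I /= !in_itv /= -!ler_norml.
have Ioo : (@lebesgue_measure R I < +oo)%E.
  by rewrite lebesgue_measure_itv; case: ifP; rewrite ?ltry // -EFinB ltry.
have IIoo : (plane_measure R (I `*` I) < +oo)%E.
  by rewrite /plane_measure product_measure1E // lte_mul_pinfty // ge0_fin_numE.
apply: (@le_lt_trans _ _ (spacetime_measure R (I `*` (I `*` I)))).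
  by apply: le_measure => //; rewrite inE //; do 2 apply: measurableX => //.
rewrite /spacetime_measure product_measure1E //; last exact: measurableX.
by rewrite lte_mul_pinfty // ge0_fin_numE.
Qed.

Lemma integrable_of_ae_bounded d (T : measurableType d) (R : realType)
    (mu : {measure set T -> \bar R}) (A : set T) (f : T -> R) (M : R) :
  measurable A -> (mu A < +oo)%E -> measurable_fun A f ->
  (\forall x \ae mu, A x -> `|f x| <= M) -> mu.-integrable A (EFin \o f).
Proof.
move=> mA Aoo mf fM; apply/integrableP; split; first exact/measurable_EFinP.
apply: (@le_lt_trans _ _ (\int[mu]_(x in A) (cst (`|M|)%R%:E) x)%E).
  apply: ae_ge0_le_integral => //.
  - by apply: measurableT_comp => //; exact/measurable_EFinP.
  - by move=> x _ /=; rewrite lee_fin.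
  - apply: filterS fM => x /[apply] fxM /=.
    by rewrite lee_fin (le_trans fxM) // ler_norm.
by rewrite integral_cst // lte_mul_pinfty.
Qed.

(** The measurability of g is a hypothesis because the measure need not be
    complete. *)
Lemma ae_eq_integrable d (T : measurableType d) (R : realType)
    (mu : {measure set T -> \bar R}) (A : set T) (f g : T -> \bar R) :
  measurable A -> measurable_fun A f -> measurable_fun A g ->
  ae_eq mu A f g -> mu.-integrable A f -> mu.-integrable A g.
Proof.
move=> mA mf mg fg /integrableP[_ foo]; apply/integrableP; split=> //.
rewrite -(ae_eq_integral _ (abse \o f)) //; try exact: measurableT_comp.
exact: ae_eq_abse.
Qed.

(** * Energy gaps and their rates *)

Lemma measurable_energy_slice (R : realType) (p e : R -> R)
    (D : riemann_data R) (rho : spacetime R -> R) (v : spacetime R -> 'cV[R]_2)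
    (t : R) :
  pressure_law p e -> entropic_weak_solution p e D rho v -> 0 < t ->
  measurable_fun setT
    (fun x : plane R => energy_density e (rho (t, x)) (v (t, x))).
Proof.
move=> Hp Hs t0; apply: measurable_energy_density; first exact: e_measurable Hp.
  apply: measurable_fun_slice => //.
  exact: measurable_fun_future (density_bounded Hs).
move=> i; apply: (measurable_fun_slice (f := fun z => v z i 0)) => //.
exact: measurable_fun_future (velocity_bounded Hs i).
Qed.

Lemma energy_gap_realization (R : realType) (p e : R -> R)
    (D : riemann_data R) (N : nat) (F : fan R N)
    (rho rho' rho_ref : spacetime R -> R)
    (v v' v_ref : spacetime R -> 'cV[R]_2) (l t : R) :
  pressure_law p e ->
  entropic_weak_solution p e D rho v ->
  entropic_weak_solution p e D rho' v' ->
  entropic_weak_solution p e D rho_ref v_ref -> 0 < t ->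
  realizes_at_time D F rho v t -> realizes_at_time D F rho' v' t ->
  (energy_gap_defined e l rho v rho_ref v_ref t <->
    energy_gap_defined e l rho' v' rho_ref v_ref t) /\
  energy_gap e l rho v rho_ref v_ref t = energy_gap e l rho' v' rho_ref v_ref t.
Proof.
move=> Hp Hs Hs' Href t0 rt rt'.
have mgap r w : entropic_weak_solution p e D r w ->
    measurable_fun (strip l) (energy_gap_density e r w rho_ref v_ref t).
  move=> Hrw; apply/measurable_EFinP; apply: measurable_funTS.
  apply: measurable_funB; first exact: measurable_energy_slice Hp Hrw t0.
  exact: measurable_energy_slice Hp Href t0.
have gapE : ae_eq (plane_measure R) (strip l)
    (energy_gap_density e rho v rho_ref v_ref t)
    (energy_gap_density e rho' v' rho_ref v_ref t).
  apply: filterS3 (ae_off_interfaces_slice F t) rt rt' => x xF xr xr' _.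
  rewrite /energy_gap_density.
  by have [_ ->] := densities_realization e (t0 : future R (t, x)) xF xr xr'.
have mS := measurable_strip l.
split; last by apply: ae_eq_integral => //; exact: mgap.
split; apply: ae_eq_integrable => //; try exact: mgap.
exact: ae_eq_sym.
Qed.

Lemma energy_rate_congr (R : realType) (G : set_system R) (e : R -> R) (l : R)
    (rho rho' rho_ref : spacetime R -> R)
    (v v' v_ref : spacetime R -> 'cV[R]_2) (t r : R) : Filter G ->
  let same s :=
    (energy_gap_defined e l rho v rho_ref v_ref s <->
      energy_gap_defined e l rho' v' rho_ref v_ref s) /\
    energy_gap e l rho v rho_ref v_ref s
      = energy_gap e l rho' v' rho_ref v_ref s in
  same t -> (\forall s \near G, same s) ->
  energy_rate G e l rho v rho_ref v_ref t r <->
  energy_rate G e l rho' v' rho_ref v_ref t r.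
Proof.
move=> FG /= [deft gapt] near_same; rewrite /energy_rate /= gapt.
split=> -[/deft dt ds rate]; split=> //.
- by apply: filterS2 near_same ds => s [defs _] /defs.
- apply: cvg_trans rate; apply: near_eq_cvg.
  by apply: filterS near_same => s [_ ->].
- by apply: filterS2 near_same ds => s [defs _] /defs.
- apply: cvg_trans rate; apply: near_eq_cvg.
  by apply: filterS near_same => s [_ ->].
Qed.

Theorem proposition2p8 (R : realType) (p e : R -> R) (D : riemann_data R)
    (N : nat) (F : fan R N)
    (rho rho' : spacetime R -> R) (v v' : spacetime R -> 'cV[R]_2)
    (Hp : pressure_law p e)
    (HF : admissible_fan_subsolution p e D F)
    (Hsol : convex_integration_realization p e D F rho v)
    (Hsol' : convex_integration_realization p e D F rho' v') :
  [/\ \forall z \ae spacetime_measure R, future R z ->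
        lagrangian_density e (rho z) (v z) = lagrangian_density e (rho' z) (v' z),
      \forall z \ae spacetime_measure R, future R z ->
        energy_density e (rho z) (v z) = energy_density e (rho' z) (v' z),
      forall A : set (spacetime R), measurable A -> bounded_set A ->
        A `<=` future R ->
        [/\ (spacetime_measure R).-integrable A
              (fun z => (lagrangian_density e (rho z) (v z))%:E),
            (spacetime_measure R).-integrable A
              (fun z => (lagrangian_density e (rho' z) (v' z))%:E) &
            (\int[spacetime_measure R]_(z in A)
               (lagrangian_density e (rho z) (v z))%:E
             = \int[spacetime_measure R]_(z in A)
               (lagrangian_density e (rho' z) (v' z))%:E)%E] &
      forall (rho_ref : spacetime R -> R) (v_ref : spacetime R -> 'cV[R]_2) (l : R),
        entropic_weak_solution p e D rho_ref v_ref -> 0 < l ->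
        forall t : R, 0 < t ->
        realizes_at_time D F rho v t -> realizes_at_time D F rho' v' t ->
        [/\ energy_gap_defined e l rho v rho_ref v_ref t <->
              energy_gap_defined e l rho' v' rho_ref v_ref t,
            energy_gap e l rho v rho_ref v_ref t
              = energy_gap e l rho' v' rho_ref v_ref t &
            forall G : set_system R, G = t^' \/ G = t^'+ ->
              (\forall s \near G, realizes_at_time D F rho v s /\
                                  realizes_at_time D F rho' v' s) ->
              forall r : R, energy_rate G e l rho v rho_ref v_ref t r <->
                            energy_rate G e l rho' v' rho_ref v_ref t r]].
Proof.
have [Hs Hs'] := (realization_solution Hsol, realization_solution Hsol').
have ae_point (P : spacetime R -> Prop) :
    (forall z, future R z -> off_interfaces F z ->
      realizes_at_point D F rho v z -> realizes_at_point D F rho' v' z -> P z) ->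
    \forall z \ae spacetime_measure R, future R z -> P z.
  move=> HP; apply: filterS3 (ae_off_interfaces F) (realization_ae Hsol)
    (realization_ae Hsol') => z zF zr zr' z0.
  exact: HP (zr z0) (zr' z0).
have Lae : \forall z \ae spacetime_measure R, future R z ->
    lagrangian_density e (rho z) (v z) = lagrangian_density e (rho' z) (v' z).
  by apply: ae_point => z z0 zF zr zr';
    have [] := densities_realization e z0 zF zr zr'.
split=> //.
- by apply: ae_point => z z0 zF zr zr';
    have [] := densities_realization e z0 zF zr zr'.
- move=> A mA bA A0.
  have mL r w : entropic_weak_solution p e D r w ->
      measurable_fun A (fun z => lagrangian_density e (r z) (w z)).
    move=> Hrw; apply: (measurable_funS (@measurable_future R)) => //.
    apply: measurable_lagrangian_density; first exact: e_measurable Hp.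
      exact: measurable_fun_future (density_bounded Hrw).
    by move=> i; exact: measurable_fun_future (velocity_bounded Hrw i).
  have Aoo := bounded_set_finite_measure mA bA.
  have [M LM] := lagrangian_bounded e D F.
  split.
  + apply: (integrable_of_ae_bounded (M := M)) => //; first exact: mL.
    by apply: filterS (ae_point _ (fun z z0 zF zr _ => LM _ _ z z0 zF zr))
      => z + /A0.
  + apply: (integrable_of_ae_bounded (M := M)) => //; first exact: mL.
    by apply: filterS (ae_point _ (fun z z0 zF _ zr' => LM _ _ z z0 zF zr'))
      => z + /A0.
  + apply: ae_eq_integral => //; try (apply/measurable_EFinP; exact: mL).
    by apply: filterS Lae => z + /A0 => /[apply] ->.
- move=> rho_ref v_ref l Href l0 t t0 rt rt'.
  have same s : 0 < s -> realizes_at_time D F rho v s ->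
      realizes_at_time D F rho' v' s -> _ :=
    @energy_gap_realization R p e D N F rho rho' rho_ref v v' v_ref l s
      Hp Hs Hs' Href.
  have [deft gapt] := same t t0 rt rt'.
  split=> // G HG near_r r.
  (* A two-sided neighbourhood of t > 0 may be shrunk to positive times, where
     the fields live. *)
  have [FG G0] : Filter G /\ \forall s \near G, 0 < s.
    have nt0 : \forall s \near t, 0 < s by exact: lt_nbhsr.
    by case: HG => ->; split; [exact: dnbhs_filter | exact: cvg_within |
      exact: at_right_proper_filter | exact: cvg_within].
  apply: energy_rate_congr; first exact: same.
  by apply: filterS2 G0 near_r => s s0 [rs rs']; exact: same.
Qed.
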